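(* For any $\beta_0\in(0,1)$, there exists $s_0\in(1,2)$ with the following property. For any $s\in(1,s_0)$ there exists a curve $E\subset\mathbb{R}^2$ such that (1) $\mathcal{H}^s(E)<\infty$ and (2) $\beta_E(Q)<\beta_0$ for all $Q\in\Delta(\mathbb{R}^2)$, but $E$ is not contained in any $(1/s)$-Hölder image of $[0,1]$; that is, there is no map $f:[0,1]\to\mathbb{R}^2$ and finite constant $H$ with $|f(x)-f(y)|\leq H|x-y|^{1/s}$ for all $x,y\in[0,1]$ and $E\subset f([0,1])$.
   Context: A curve is a continuous image of $[0,1]$. $\mathcal{H}^s$ is $s$-dimensional Hausdorff measure. $\Delta(\mathbb{R}^2)$ is the family of dyadic squares $[2^km_1,2^k(m_1+1)]\times[2^km_2,2^k(m_2+1)]$ with $m_1,m_2,k\in\mathbb{Z}$. For a nonempty set $E\subset\mathbb{R}^2$ and a bounded set $Q\subset\mathbb{R}^2$ of positive diameter, the Jones beta number is $$\beta_E(Q):=\inf_\ell\sup_{x\in E\cap Q}\frac{\operatorname{dist}(x,\ell)}{\operatorname{diam}Q}$$ if $E\cap Q\neq\emptyset$, where $\ell$ ranges over all straight lines in $\mathbb{R}^2$, and $\beta_E(Q):=0$ if $E\cap Q=\emptyset$. *)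

(* Defs.v *)
From mathcomp Require Import all_boot all_order all_algebra.
From mathcomp Require Import all_classical all_reals all_analysis.
Set Implicit Arguments.
Unset Strict Implicit.
Unset Printing Implicit Defensive.
Import Order.TTheory GRing.Theory Num.Theory.
Import numFieldNormedType.Exports.
Local Open Scope classical_set_scope.
Local Open Scope ring_scope.

(* The plane is [R * R].  The library gives it the product topology, which is
   the Euclidean one, but the sup norm; the Euclidean distance is defined here. *)
Definition edist2 (R : realType) (x y : R * R) : R :=
  Num.sqrt ((x.1 - y.1) ^+ 2 + (x.2 - y.2) ^+ 2).

(* Adjoining 0 makes the diameter of the empty set 0 instead of [-oo]. *)
Definition diam2 (R : realType) (A : set (R * R)) : \bar R :=
  ereal_sup (0%E |` [set (edist2 xy.1 xy.2)%:E | xy in A `*` A]).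

(* Only meant for [0 < s]: [poweR] gives 0 `^ 0 = 1, so that at [s = 0] even an
   empty member of a cover would contribute 1. *)
Definition hausdorff_content (R : realType) (s delta : R) (E : set (R * R)) :
    \bar R :=
  ereal_inf [set (\sum_(0 <= n <oo) poweR (diam2 (A n)) s)%E
    | A in [set A : (set (R * R))^nat |
        E `<=` \bigcup_n A n /\ forall n, (diam2 (A n) <= delta%:E)%E]].

Definition hausdorff_measure (R : realType) (s : R) (E : set (R * R)) : \bar R :=
  ereal_sup [set hausdorff_content s delta E | delta in [set d : R | 0 < d]].

Definition is_line (R : realType) (l : set (R * R)) : Prop :=
  exists p v : R * R, v != (0, 0) /\
    l = [set (p.1 + t * v.1, p.2 + t * v.2) | t in [set: R]].

(* A real infimum, hence only meaningful for nonempty [l]. *)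
Definition dist_to_set (R : realType) (x : R * R) (l : set (R * R)) : R :=
  inf [set edist2 x y | y in l].

(* Jones beta number, for [Q] bounded of positive diameter. *)
Definition beta_number (R : realType) (E Q : set (R * R)) : \bar R :=
  if E `&` Q == set0 then 0%E
  else ereal_inf
    [set ereal_sup [set (dist_to_set x l / fine (diam2 Q))%:E | x in E `&` Q]
      | l in @is_line R].

Definition dyadic_square (R : realType) (k m1 m2 : int) : set (R * R) :=
  `[((2 : R) ^ k * m1%:~R)%R, ((2 : R) ^ k * (m1 + 1)%:~R)%R]%classic `*`
  `[((2 : R) ^ k * m2%:~R)%R, ((2 : R) ^ k * (m2 + 1)%:~R)%R]%classic.

Definition dyadic_squares (R : realType) : set (set (R * R)) :=
  [set Q | exists k m1 m2 : int, Q = dyadic_square k m1 m2].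

Definition is_curve (R : realType) (E : set (R * R)) : Prop :=
  exists g : R -> R * R,
    {within `[0, 1], continuous g} /\ E = g @` `[0, 1].

(* The values of [f] outside [0, 1] are irrelevant. *)
Definition holder_on_unit (R : realType) (alpha H : R) (f : R -> R * R) : Prop :=
  forall x y : R, x \in `[0, 1] -> y \in `[0, 1] ->
    edist2 (f x) (f y) <= H * `|x - y| `^ alpha.

(* Main.v *)
Require Import Defs.
From mathcomp Require Import all_boot all_order all_algebra.
From mathcomp Require Import all_classical all_reals all_analysis.
From mathcomp Require Import ring lra zify.
Import Order.TTheory GRing.Theory Num.Theory.
Import numFieldNormedType.Exports.
Local Open Scope classical_set_scope.
Local Open Scope ring_scope.
Set Implicit Arguments.
Unset Strict Implicit.

(** The curve is a flat von Koch curve in which some of the folds are left out.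

    Fix eps = beta0 / 4. A unit segment is replaced by two halves of itself: in
    an up step by the two legs of the isosceles triangle of height eps / 2 over
    it, in a down step by its left and right halves. In an up step the two
    similarities reverse orientation, so that they map the triangle into itself
    ([mapL_triangle], [mapR_triangle]). A sequence sg of booleans prescribes
    which steps are up, and the limit is a curve E(sg), the union of the images
    of E(sg'), for the shifted sequence sg', under the two maps of the first
    step.

    The geometry rests on one fact: seen from their common point, the two images
    of the triangle lie in opposite cones about the horizontal direction, of
    slope 3 eps ([mapL_cone], [mapR_cone]). It has two consequences.
    - Flatness ([fold_set_flat]). Let A be a subset of E(sg) of diameter at most
      d. If A meets both halves then, the angle at the common point being
      obtuse, A lies within d of that point, hence within 3 eps d of the
      horizontal line through it. Otherwise A lies in one half, which is a
      smaller copy of a curve of the same family, and one iterates. Hence all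
      the beta numbers are at most 3 eps < beta0.
    - Packing ([fold_set_packing]). At stage k the curve contains 2 ^ k points
      whose mutual distances are at least r_k, the size of the pieces of that
      stage, because an obtuse angle makes the distance between points in
      different halves at least their distances to the common point.

    The 2 ^ k pieces of size r_k cover E(sg), so that the H^s measure of E(sg) is
    finite as soon as w_k = 2 ^ k * r_k ^ s stays bounded along a subsequence
    ([fold_set_hausdorff]). A (1 / s)-Holder map with constant H needs time at
    least (r_k / H) ^ s between two of the separated points, so that if its image
    contains E(sg) then w_k is bounded ([fold_set_not_holder]). An up step
    multiplies w_k by a factor which exceeds 1 when s is less than the dimension
    s0 of the curve with up steps only, and a down step by 2 ^ (1 - s) < 1. It
    remains to choose sg in alternating blocks of rapidly increasing lengths, so
    that w_k is at most 1 infinitely often but unbounded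
    ([oscillating_products]). *)

(** * Squared distances, diameters and lines *)

(** The square of the Euclidean distance: it is polynomial in the coordinates, and
    similarities multiply it by a constant. *)
Definition sqdist (R : realType) (p q : R * R) : R :=
  (p.1 - q.1) ^+ 2 + (p.2 - q.2) ^+ 2.

Lemma edist2E (R : realType) (p q : R * R) :
  edist2 p q = Num.sqrt (sqdist p q).
Proof. by []. Qed.

Lemma sqdist_ge0 (R : realType) (p q : R * R) : 0 <= sqdist p q.
Proof. by rewrite addr_ge0 // sqr_ge0. Qed.

Lemma sqdistC (R : realType) (p q : R * R) : sqdist p q = sqdist q p.
Proof. by rewrite /sqdist; ring. Qed.

(** A substitute for the triangle inequality which avoids square roots. *)
Lemma sqdist_le_add (R : realType) (p q z : R * R) :
  sqdist p q <= 2 * (sqdist p z + sqdist q z).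
Proof.
rewrite /sqdist.
have := sqr_ge0 (p.1 - z.1 + (q.1 - z.1)); have := sqr_ge0 (p.2 - z.2 + (q.2 - z.2)).
by lra.
Qed.

Lemma edist2_leP (R : realType) (p q : R * R) (d : R) : 0 <= d ->
  (edist2 p q <= d) = (sqdist p q <= d ^+ 2).
Proof.
move=> d0; rewrite edist2E -[in RHS]ler_sqrt ?sqr_ge0 //.
by rewrite sqrtr_sqr ger0_norm.
Qed.

Lemma sqdist_eq0 (R : realType) (p q : R * R) : sqdist p q <= 0 -> p = q.
Proof.
rewrite /sqdist => h.
have := sqr_ge0 (p.1 - q.1); have := sqr_ge0 (p.2 - q.2) => h2 h1.
have /eqP : (p.1 - q.1) ^+ 2 = 0 by lra.
have /eqP : (p.2 - q.2) ^+ 2 = 0 by lra.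
rewrite !sqrf_eq0 !subr_eq0 => /eqP e2 /eqP e1.
by case: p q e1 e2 {h h1 h2} => [a b] [c d] /= -> ->.
Qed.

Lemma diam2_le (R : realType) (A : set (R * R)) (l : R) : 0 <= l ->
  (forall p q, A p -> A q -> edist2 p q <= l) -> (diam2 A <= l%:E)%E.
Proof.
move=> l0 h; apply: ge_ereal_sup => _ [->|[[p q] [/= Ap Aq] <-]].
  by rewrite lee_fin.
by rewrite lee_fin; exact: h.
Qed.

Lemma diam2_ge0 (R : realType) (A : set (R * R)) : (0 <= diam2 A)%E.
Proof. by apply: ereal_sup_ubound; left. Qed.

Lemma edist2_le_diam2 (R : realType) (A : set (R * R)) p q :
  A p -> A q -> ((edist2 p q)%:E <= diam2 A)%E.
Proof. by move=> Ap Aq; apply: ereal_sup_ubound; right; exists (p, q). Qed.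

Lemma diam2_set0 (R : realType) : diam2 (@set0 (R * R)) = 0%E.
Proof. by apply/eqP; rewrite eq_le diam2_ge0 andbT; apply: diam2_le. Qed.

(** Finite covers suffice to bound the Hausdorff measure from above: they are
    completed by empty sets, which contribute 0 since [s] is nonzero. *)
Lemma hausdorff_measure_le (R : realType) (s C : R) (E : set (R * R)) : 0 < s ->
  (forall delta, 0 < delta -> exists (n : nat) (A : nat -> set (R * R)) (l : R),
     [/\ 0 <= l <= delta, (forall p, E p -> exists2 i, (i < n)%N & A i p),
         (forall i p q, A i p -> A i q -> edist2 p q <= l)
       & n%:R * l `^ s <= C]) ->
  (hausdorff_measure s E <= C%:E)%E.
Proof.
move=> s0 h; apply: ge_ereal_sup => _ [delta /= d0 <-].
have [n [A [l [/andP[l0 ld] cov dA hC]]]] := h _ d0.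
pose A' i := if (i < n)%N then A i else set0.
have dA' i : (diam2 (A' i) <= l%:E)%E.
  rewrite /A'; case: ifP => _; last by rewrite diam2_set0 lee_fin.
  by apply: diam2_le => // p q; exact: dA.
apply: (@le_trans _ _ (\sum_(0 <= i <oo) poweR (diam2 (A' i)) s)%E).
  apply: ereal_inf_lbound; exists A' => //; split.
    by move=> p /cov [i ni Ap]; exists i => //; rewrite /A' ni.
  by move=> i; apply: le_trans (dA' i) _; rewrite lee_fin.
rewrite (nneseries_split 0 n); last by move=> *; exact: poweR_ge0.
rewrite add0n eseries0 => [|i ni _]; last first.
  by rewrite /A' ltnNge ni /= diam2_set0 poweR0r // gt_eqF.
rewrite adde0; apply: (@le_trans _ _ (\sum_(0 <= i < n) (l `^ s)%:E)%E).
  apply: lee_sum => i _; rewrite -poweR_EFin.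
  apply: gt0_ler_poweR; rewrite ?(ltW s0) // in_itv /= ?leey ?andbT ?lee_fin //.
  exact: diam2_ge0.
by rewrite sumEFin lee_fin sumr_const_nat subn0 -mulr_natl.
Qed.

(** [A] lies within squared distance [c] of some straight line, which is given by
    a point [p] and a direction [v]. *)
Definition near_line (R : realType) (A : set (R * R)) (c : R) :=
  exists p v : R * R, v != (0, 0) /\
  forall x, A x -> exists t, sqdist x (p.1 + t * v.1, p.2 + t * v.2) <= c.

(** The third hypothesis says that [F] is affine on every line. *)
Lemma near_line_similar (R : realType) (F : R * R -> R * R) (r : R)
    (A : set (R * R)) (c : R) :
  0 < r -> (forall p q, sqdist (F p) (F q) = r * sqdist p q) ->
  (forall p v t, F (p.1 + t * v.1, p.2 + t * v.2) =
     ((F p).1 + t * ((F v).1 - (F (0, 0)).1),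
      (F p).2 + t * ((F v).2 - (F (0, 0)).2))) ->
  near_line A c -> near_line (F @` A) (r * c).
Proof.
move=> r0 Fs Fa [p [v [v0 h]]].
exists (F p), ((F v).1 - (F (0, 0)).1, (F v).2 - (F (0, 0)).2); split.
  apply/eqP => -[/eqP e1 /eqP e2]; move/eqP: v0; apply; apply: sqdist_eq0.
  rewrite -(pmulr_rle0 _ r0) -Fs /sqdist.
  by rewrite (eqP e1) (eqP e2) expr0n /= addr0.
move=> _ [x Ax <-]; have [t ht] := h _ Ax; exists t.
by rewrite -Fa Fs ler_pM2l.
Qed.

Lemma beta_number_le (R : realType) (E Q : set (R * R)) (c d : R) :
  0 <= c -> 0 < d -> diam2 Q = d%:E ->
  near_line (E `&` Q) (c ^+ 2 * d ^+ 2) -> (beta_number E Q <= c%:E)%E.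
Proof.
move=> c0 d0 dQ [p [v [v0 h]]]; rewrite /beta_number.
case: ifP => _; first by rewrite lee_fin.
pose l : set (R * R) := [set (p.1 + t * v.1, p.2 + t * v.2) | t in [set: R]].
apply: (@le_trans _ _ (ereal_sup
    [set (dist_to_set x l / fine (diam2 Q))%:E | x in E `&` Q])).
  by apply: ereal_inf_lbound; exists l => //; exists p, v.
apply: ge_ereal_sup => _ [x EQx <-]; rewrite dQ /= lee_fin ler_pdivrMr //.
have [t ht] := h _ EQx.
apply: (@le_trans _ _ (edist2 x (p.1 + t * v.1, p.2 + t * v.2))).
  apply: ge_inf; last by exists (p.1 + t * v.1, p.2 + t * v.2) => //; exists t.
  by exists 0 => _ [y _ <-]; exact: sqrtr_ge0.
by rewrite edist2_leP ?mulr_ge0 ?(ltW d0) // exprMn.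
Qed.

Lemma diam2_dyadic (R : realType) (Q : set (R * R)) : dyadic_squares Q ->
  exists2 d : R, 0 < d & diam2 Q = d%:E.
Proof.
case=> k [m1 [m2 ->]]; set Q0 := dyadic_square _ _ _.
pose a : R := 2 ^ k; have a0 : 0 < a by apply: exprz_gt0.
have e m : (2 : R) ^ k * (m + 1)%:~R = a * m%:~R + a.
  by rewrite -/a intrD mulrDr mulr1.
have Q1 : Q0 (a * m1%:~R, a * m2%:~R).
  by split; rewrite /= in_itv /= e lexx lerDl ltW.
have Q2 : Q0 (a * m1%:~R + a, a * m2%:~R).
  by split; rewrite /= in_itv /= e !lexx lerDl ltW.
have up : (diam2 Q0 <= (2 * a)%:E)%E.
  apply: diam2_le => [|p q]; first by rewrite mulr_ge0 // ltW.
  rewrite /Q0 /dyadic_square => -[/= hp1 hp2] [/= hq1 hq2].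
  move: hp1 hp2 hq1 hq2; rewrite !in_itv /= !e -/a => /andP[p1 p1'] /andP[p2 p2'].
  move=> /andP[q1 q1'] /andP[q2 q2'].
  have sq x : - a <= x <= a -> x ^+ 2 <= a ^+ 2.
    move=> hx; rewrite -(real_normK (num_real x)) lerXn2r ?nnegrE ?(ltW a0) //.
    by rewrite ler_norml.
  rewrite edist2_leP ?mulr_ge0 ?(ltW a0) // /sqdist exprMn.
  have -> : 2 ^+ 2 * a ^+ 2 = a ^+ 2 + a ^+ 2 + 2 * a ^+ 2 by ring.
  apply: ler_wpDr; first by rewrite mulr_ge0 // sqr_ge0.
  by apply: lerD; apply: sq; apply/andP; split; lra.
have low : (a%:E <= diam2 Q0)%E.
  apply: le_trans (edist2_le_diam2 Q2 Q1); rewrite lee_fin edist2E /sqdist /=.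
  by rewrite [_ + a]addrC addrK subrr expr0n /= addr0 sqrtr_sqr ler_norm.
move: up low; case: (diam2 Q0) => [d| |] //=.
by rewrite !lee_fin => _ ad; exists d => //; apply: lt_le_trans ad.
Qed.

(** * Sequences and products *)

Lemma geometric_below (R : realType) (z C e : R) :
  0 <= z < 1 -> 0 < C -> 0 < e -> exists n, C * z ^+ n < e.
Proof.
move=> /andP[z0 z1] C0 e0.
have q0 : `|z| < 1 by rewrite ger0_norm.
have /cvgr0Pnorm_lt /(_ (e / C)) := cvg_expr q0.
rewrite divr_gt0 // => /(_ isT) [N _ /(_ N (leqnn _))] /= hN.
exists N; rewrite mulrC -ltr_pdivlMr //.
by apply: le_lt_trans hN; rewrite ler_norm.
Qed.

Lemma lt01_9_16 (R : realType) : 0 <= (9/16 : R) < 1.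
Proof. by apply/andP; split; lra. Qed.

(** The increments are at most 2 * (3/4) ^ n in absolute value. *)
Lemma cvg_geometric_step (R : realType) (u : nat -> R) :
  (forall n, (u n.+1 - u n) ^+ 2 <= 2 * (9/16) ^+ n) -> cvgn u.
Proof.
move=> hu.
have hs n : `|telescope u n| <= geometric 2 (3/4) n.
  have g0 : 0 <= geometric (2 : R) (3/4) n.
    by rewrite /= mulr_ge0 // exprn_ge0 //; lra.
  rewrite -(@ler_pXn2r _ 2%N) ?nnegrE //= /telescope /=.
  rewrite real_normK ?num_real //; apply: le_trans (hu n) _.
  have -> : (2 * (3/4) ^+ n) ^+ 2 = 2 ^+ 2 * (9/16) ^+ n :> R.
    rewrite [LHS]exprMn exprAC; congr (_ * _ ^+ n); by field.
  by rewrite ler_wpM2r // ?exprn_ge0 //; lra.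
have cs : cvgn (series (telescope u)).
  apply: normed_cvg.
  apply: (@series_le_cvg _ _ (geometric 2 (3/4))) => //.
  - by move=> n; exact: normr_ge0.
  - by move=> n; rewrite /= mulr_ge0 // exprn_ge0 //; lra.
  - by apply: is_cvg_geometric_series; rewrite ger0_norm; lra.
have -> : u = (fun n => u 0%N + series (telescope u) n).
  by apply/funext => n; rewrite -eq_sum_telescope.
by apply: is_cvgD => //; exact: is_cvg_cst.
Qed.

(** The factors [U] and [D] can be arranged so that the partial products are at
    most 1 infinitely often, yet unbounded. The choice is constant on each block of
    indices from B ^ j to B ^ j.+1, and alternates with the parity of [j]; for [B]
    large, each block outweighs all that precedes it. *)
Lemma oscillating_products (R : realType) (U D : R) : 1 < U -> 0 < D < 1 ->
  exists sg : nat -> bool,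
    (forall N, exists2 k, (N <= k)%N & \prod_(i < k) (if sg i then U else D) <= 1) /\
    (forall M, exists2 k, (0 < k)%N & M < \prod_(i < k) (if sg i then U else D)).
Proof.
move=> U1 /andP[D0 D1].
have U0 : 0 < U by apply: lt_trans U1.
have DU : D <= U by apply/ltW/(lt_trans D1).
have [m hm] : exists m, 2 <= D * U ^+ m.+1 /\ U * D ^+ m.+1 <= 1.
  have [m1 h1] : exists n, U * D ^+ n < 1.
    by apply: geometric_below => //; rewrite D1 ltW.
  have [m2 h2] : exists n, 2 / D * U^-1 ^+ n < 1.
    by apply: geometric_below; rewrite ?divr_gt0 // invr_ge0 (ltW U0) invf_lt1.
  exists (m1 + m2)%N; split.
    move: h2; rewrite exprVn ltr_pdivrMr ?exprn_gt0 // mul1r ltr_pdivrMr //.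
    move=> /ltW h2.
    rewrite mulrC; apply: le_trans h2 _; rewrite ler_pM2r // ler_eXn2l //.
    by lia.
  apply: le_trans (ltW h1); rewrite ler_pM2l // -addnS exprD.
  by rewrite ler_piMr ?exprn_ge0 ?exprn_ile1 ?(ltW D0) ?(ltW D1).
pose B := m.+2; pose g b := if b : bool then U else D.
pose sg i := odd (trunc_log B i).
pose w k := \prod_(i < k) g (sg i).
have B1 : (1 < B)%N by [].
have block j : w (B ^ j.+1)%N = w (B ^ j)%N * g (odd j) ^+ (m.+1 * B ^ j).
  have -> : (B ^ j.+1 = B ^ j + m.+1 * B ^ j)%N by rewrite expnS /B mulSn.
  rewrite {1}/w big_split_ord /=; congr (_ * _).
  rewrite -[in RHS](card_ord (m.+1 * B ^ j)%N) -prodr_const.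
  apply: eq_bigr => i _; congr (g (odd _)); apply: trunc_log_eq => //.
  rewrite leq_addr /=; apply: (@leq_trans (B ^ j + m.+1 * B ^ j)%N).
    by rewrite ltn_add2l ltn_ord.
  by rewrite expnS -mulSn.
have gD b : D <= g b by case: b.
have gU b : g b <= U by case: b.
have g0 b : 0 < g b by apply: lt_le_trans (gD b).
have wD k : D ^+ k <= w k.
  elim: k => [|k IH]; first by rewrite /w big_ord0.
  rewrite /w big_ord_recr exprSr /=.
  by apply: ler_pM; rewrite // ?exprn_ge0 ?(ltW D0).
have w0 k : 0 < w k by apply: prodr_gt0.
have wU k : w k <= U ^+ k.
  elim: k => [|k IH]; first by rewrite /w big_ord0.
  rewrite /w big_ord_recr exprSr /=.
  by apply: ler_pM; rewrite // ?(ltW (w0 k)) ?(ltW (g0 _)).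
exists sg; split=> [N|M].
  exists (B ^ (N.*2).+1)%N.
    have hN : (N <= (N.*2).+1)%N by lia.
    exact: leq_trans hN (ltnW (ltn_expl _ B1)).
  rewrite -/(w _) block odd_double /= exprM.
  apply: (@le_trans _ _ ((U * D ^+ m.+1) ^+ (B ^ N.*2))).
    by rewrite exprMn ler_pM2r ?exprn_gt0.
  by rewrite exprn_ile1 ?mulr_ge0 ?exprn_ge0 ?(ltW U0) ?(ltW D0) //; case: hm.
pose j := (Num.trunc M).*2.+1.
exists (B ^ j.+1)%N; first by rewrite expn_gt0.
rewrite -/(w _) block /= odd_double /= exprM.
apply: (@lt_le_trans _ _ ((D * U ^+ m.+1) ^+ (B ^ j))); last first.
  by rewrite exprMn ler_pM2r ?exprn_gt0.
apply: (@lt_le_trans _ _ (2 ^+ (B ^ j))); last first.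
  by rewrite lerXn2r ?nnegrE ?mulr_ge0 ?exprn_ge0 ?(ltW U0) ?(ltW D0) //; case: hm.
apply: lt_le_trans (truncnS_gt M) _.
rewrite -natrX ler_nat.
apply: (leq_trans _ (ltnW (ltn_expl _ _))) => //.
have hj : (Num.trunc M < j)%N by rewrite /j; lia.
exact: leq_trans hj (ltnW (ltn_expl _ B1)).
Qed.

(** * Separated points on a Holder curve *)

(** [N] points at mutual squared distance at least [d2] on a (1 / s)-Holder curve
    have parameters which are [eta] apart, where [eta] is the quotient of
    [d2 `^ (s / 2)] by [(`|H| + 1) `^ s]. Dividing the parameters by [eta] and
    rounding down is therefore injective, which bounds [N] by 1 / eta + 1. *)
Lemma holder_packing (R : realType) (f : R -> R * R) (H s d2 : R) (N : nat)
    (z : nat -> R * R) :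
  0 < s -> holder_on_unit (1 / s) H f -> 0 < d2 -> (1 < N)%N ->
  (forall i, (i < N)%N -> (f @` `[0, 1]) (z i)) ->
  (forall i j, (i < j)%N -> (j < N)%N -> d2 <= sqdist (z i) (z j)) ->
  N%:R * d2 `^ (s / 2) <= 2 * (`|H| + 1) `^ s.
Proof.
move=> s0 fH d0 N1 fz sep.
(* [H] itself might be zero or negative. *)
pose K := `|H| + 1.
have K0 : 0 < K by rewrite ltr_wpDl.
have Ks0 : 0 < K `^ s by apply: powR_gt0.
have /choice[x hx] : forall i : 'I_N, exists t, t \in `[0, 1] /\ f t = z i.
  by move=> i; have [t t01 ft] := fz i (ltn_ord i); exists t.
have gap (i j : 'I_N) : (i < j)%N -> d2 `^ (s / 2) <= K `^ s * `|x i - x j|.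
  move=> ij; have [xi fi] := hx i; have [xj fj] := hx j.
  have h : Num.sqrt d2 <= K * `|x i - x j| `^ (1 / s).
    apply: (@le_trans _ _ (edist2 (f (x i)) (f (x j)))).
      by rewrite edist2E ler_sqrt ?sqdist_ge0 // fi fj; exact: sep.
    apply: le_trans (fH _ _ xi xj) _; rewrite ler_wpM2r ?powR_ge0 //.
    by apply: le_trans (ler_norm _) _; rewrite lerDl.
  have := ge0_ler_powR (ltW s0) _ _ h.
  rewrite !nnegrE sqrtr_ge0 mulr_ge0 ?powR_ge0 ?(ltW K0) // => /(_ isT isT).
  rewrite powRM ?powR_ge0 ?(ltW K0) // -powRrM mul1r mulVf ?gt_eqF // powRr1 //.
  by rewrite -(powR12_sqrt (ltW d0)) -powRrM [2^-1 * s]mulrC.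
pose eta := d2 `^ (s / 2) / K `^ s.
have e0 : 0 < eta by rewrite divr_gt0 // powR_gt0.
have gap' (i j : 'I_N) : (i < j)%N -> eta <= `|x i - x j|.
  by move=> /gap; rewrite /eta ler_pdivrMr // [_ * K `^ s]mulrC.
have x01 i : 0 <= x i <= 1 by have [] := hx i; rewrite in_itv.
have e1 : eta <= 1.
  apply: le_trans (gap' (Ordinal (ltnW N1)) (Ordinal N1) isT) _.
  have /andP[a0 a1] := x01 (Ordinal (ltnW N1)).
  have /andP[b0 b1] := x01 (Ordinal N1).
  by rewrite ler_norml; apply/andP; split; lra.
pose c (i : 'I_N) : nat := Num.trunc (x i / eta).
have xe0 i : 0 <= x i / eta by rewrite divr_ge0 ?(ltW e0) //; case/andP: (x01 i).
have cP i : (c i < (Num.trunc (1 / eta)).+1)%N.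
  rewrite ltnS; apply: le_truncn; rewrite ler_pM2r ?invr_gt0 //.
  by case/andP: (x01 i).
have c_inj' (i j : 'I_N) : (i < j)%N -> c i <> c j.
  move=> ij cij; have := gap' _ _ ij; apply/negP; rewrite -ltNge.
  have /andP[a1 a2] := truncn_itv (xe0 i); have /andP[b1 b2] := truncn_itv (xe0 j).
  move: a1 a2 b1 b2; rewrite -/(c i) -/(c j) cij.
  rewrite !ler_pdivlMr // !ltr_pdivrMr // -natr1 => a1 a2 b1 b2.
  by rewrite ltr_norml; apply/andP; split; lra.
have c_inj : injective (fun i => Ordinal (cP i)).
  move=> i j [cij]; apply/val_inj; case: (ltngtP i j) => // ij.
    by case: (c_inj' _ _ ij).
  by case: (c_inj' _ _ ij).
have := leq_card _ c_inj; rewrite !card_ord -(ler_nat R) -natr1 => hN.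
have ht : (Num.trunc (1 / eta))%:R <= 1 / eta by rewrite truncn_le divr_ge0 // ltW.
have e1' : 1 <= 1 / eta by rewrite ler_pdivlMr // mul1r.
have : N%:R <= 2 / eta by lra.
by rewrite ler_pdivlMr // /eta mulrA ler_pdivrMr.
Qed.

(** * The folding maps and the invariant triangle *)

Section Folding.
Variables (R : realType) (eps : R).
(* In particular 3 eps < 1, which makes the angle between the two cones obtuse. *)
Hypotheses (eps_gt0 : 0 < eps) (eps_le : eps <= 1/4).
Implicit Types (b : bool) (p q : R * R) (sg : nat -> bool) (n k : nat).

(** With a = (1 + i eps) / 2 and the plane seen as the complex numbers, an up step
    uses z |-> a z^* and z |-> a + (1 - a) z^*, and a down step z |-> z / 2 and
    z |-> (1 + z) / 2. [mapL] is the first and [mapR] the second map of the step;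
    the boolean is true for an up step. *)
Definition mapL b p : R * R :=
  if b then ((p.1 + eps * p.2) / 2, (eps * p.1 - p.2) / 2)
  else (p.1 / 2, p.2 / 2).

Definition mapR b p : R * R :=
  if b then ((1 + p.1 - eps * p.2) / 2, (eps - eps * p.1 - p.2) / 2)
  else ((1 + p.1) / 2, p.2 / 2).

(** The square of the ratio of the two similarities [mapL b] and [mapR b]. *)
Definition ratio2 b : R := if b then (1 + eps ^+ 2) / 4 else 1 / 4.

(** The triangle with vertices 0, 1 and (1 + i eps) / 2. *)
Definition in_triangle p :=
  [/\ 0 <= p.2, p.2 <= eps * p.1 & p.2 <= eps * (1 - p.1)].

Lemma eps_sq_le : eps ^+ 2 <= 1/16.
Proof.
have h : 0 <= 1/4 - eps by rewrite subr_ge0.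
have := mulr_ge0 (ltW eps_gt0) h; lra.
Qed.

Lemma ratio2_gt0 b : 0 < ratio2 b.
Proof. by have := sqr_ge0 eps; case: b; rewrite /ratio2; lra. Qed.

Lemma ratio2_le b : ratio2 b <= 9/16.
Proof. by have := eps_sq_le; case: b; rewrite /ratio2; lra. Qed.

Lemma sqdist_mapL b p q : sqdist (mapL b p) (mapL b q) = ratio2 b * sqdist p q.
Proof. by case: b; rewrite /sqdist /ratio2 /=; field. Qed.

Lemma sqdist_mapR b p q : sqdist (mapR b p) (mapR b q) = ratio2 b * sqdist p q.
Proof. by case: b; rewrite /sqdist /ratio2 /=; field. Qed.

Lemma mapL0 b : mapL b (0, 0) = (0, 0).
Proof. by case: b; rewrite /mapL /=; congr pair; field. Qed.

Lemma mapR1 b : mapR b (1, 0) = (1, 0).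
Proof. by case: b; rewrite /mapR /=; congr pair; field. Qed.

Lemma mapL1 b : mapL b (1, 0) = mapR b (0, 0).
Proof. by case: b; rewrite /mapL /mapR /=; congr pair; field. Qed.

Lemma triangle_x p : in_triangle p -> 0 <= p.1 <= 1.
Proof.
have he := eps_gt0.
case=> h0 h1 h2; rewrite -[p.1 <= 1]subr_ge0 -(pmulr_rge0 p.1 he).
by rewrite -(pmulr_rge0 (1 - p.1) he); apply/andP; split; lra.
Qed.

(** With these bounds on products, the inclusions below are linear arithmetic. *)
Lemma triangle_bounds p : in_triangle p ->
  [/\ 0 <= eps * p.2, eps * p.2 <= p.1 / 16, eps * p.2 <= (1 - p.1) / 16
    & 0 <= eps ^+ 2 * p.2 <= p.2 / 16].
Proof.
move=> tp; have /andP[x0 x1] := triangle_x tp; case: tp => h0 h1 h2.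
have he := ltW eps_gt0; have x1' : 0 <= 1 - p.1 by rewrite subr_ge0.
have k0 := ler_wpM2r h0 eps_sq_le; have k1 := ler_wpM2r x0 eps_sq_le.
have k2 := ler_wpM2r x1' eps_sq_le.
have l1 := ler_wpM2l he h1; have l2 := ler_wpM2l he h2.
split; [exact: mulr_ge0|lra|lra|apply/andP; split; last lra].
by rewrite mulr_ge0 // sqr_ge0.
Qed.

Lemma triangle0 : in_triangle (0, 0).
Proof. by have he := eps_gt0; split=> /=; lra. Qed.

Lemma triangle1 : in_triangle (1, 0).
Proof. by have he := eps_gt0; split=> /=; lra. Qed.

Lemma mapL_triangle b p : in_triangle p -> in_triangle (mapL b p).
Proof.
move=> tp; have [m0 m1 m2 /andP[m3 m4]] := triangle_bounds tp.
by have he := eps_gt0; case: tp => h0 h1 h2; case: b; split=> /=; lra.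
Qed.

Lemma mapR_triangle b p : in_triangle p -> in_triangle (mapR b p).
Proof.
move=> tp; have [m0 m1 m2 /andP[m3 m4]] := triangle_bounds tp.
by have he := eps_gt0; case: tp => h0 h1 h2; case: b; split=> /=; lra.
Qed.

Lemma sqdist_triangle p q : in_triangle p -> in_triangle q -> sqdist p q <= 2.
Proof.
have sq_le1 (x : R) : -1 <= x <= 1 -> x ^+ 2 <= 1.
  by rewrite -ler_norml => h; rewrite -real_normK ?num_real ?exprn_ile1.
have he := eps_le.
move=> tp tq; have /andP[x0 x1] := triangle_x tp.
have /andP[y0 y1] := triangle_x tq.
have hx1 : 0 <= 1 - p.1 by rewrite subr_ge0.
have hy1 : 0 <= 1 - q.1 by rewrite subr_ge0.
have := ler_wpM2r hx1 he; have := ler_wpM2r hy1 he.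
case: tp => h0 h1 h2; case: tq => g0 g1 g2 k1 k2.
rewrite /sqdist; have -> : (2 : R) = 1 + 1 by ring.
by apply: lerD; apply: sq_le1; apply/andP; split; lra.
Qed.

(** The images of the triangle under [mapL b] and [mapR b] share the point
    [mapL b (1, 0)]. Seen from there, the first one lies to the left in a cone of
    slope 3 eps about the horizontal line, the second one to the right. *)
Lemma mapL_cone b p : in_triangle p ->
  let u := (mapL b p).1 - (mapL b (1, 0)).1 in
  let v := (mapL b p).2 - (mapL b (1, 0)).2 in
  u <= 0 /\ `|v| <= - (3 * eps * u).
Proof.
move=> tp; have [m0 m1 m2 /andP[m3 m4]] := triangle_bounds tp.
have /andP[x0 x1] := triangle_x tp; case: tp => h0 h1 h2.
by case: b; rewrite /= ler_norml; split; try (apply/andP; split); lra.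
Qed.

Lemma mapR_cone b p : in_triangle p ->
  let u := (mapR b p).1 - (mapL b (1, 0)).1 in
  let v := (mapR b p).2 - (mapL b (1, 0)).2 in
  0 <= u /\ `|v| <= 3 * eps * u.
Proof.
move=> tp; have [m0 m1 m2 /andP[m3 m4]] := triangle_bounds tp.
have /andP[x0 x1] := triangle_x tp; case: tp => h0 h1 h2.
by case: b; rewrite /= ler_norml; split; try (apply/andP; split); lra.
Qed.

(** The angle at the common point of the two images is at least a right angle. *)
Lemma obtuse_angle b p q : in_triangle p -> in_triangle q ->
  sqdist (mapL b p) (mapL b (1, 0)) + sqdist (mapR b q) (mapL b (1, 0))
    <= sqdist (mapL b p) (mapR b q).
Proof.
move=> /(mapL_cone b) /= [u0 hv] /(mapR_cone b) /= [u0' hv'].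
rewrite /sqdist; move: u0 hv u0' hv'.
set u := (mapL b p).1 - _; set v := (mapL b p).2 - _.
set u' := (mapR b q).1 - _; set v' := (mapR b q).2 - _.
move=> u0 hv u0' hv'.
have -> : (mapL b p).1 - (mapR b q).1 = u - u' by rewrite /u /u'; ring.
have -> : (mapL b p).2 - (mapR b q).2 = v - v' by rewrite /v /v'; ring.
suff : u * u' + v * v' <= 0 by lra.
have hvv : v * v' <= `|v| * `|v'| by rewrite -normrM ler_norm.
have he : 0 <= 1 - 3 * eps by have := eps_le; lra.
have h1 : `|v| <= - u.
  apply: le_trans hv _; rewrite -subr_ge0.
  have -> : - u - - (3 * eps * u) = (1 - 3 * eps) * - u by ring.
  by rewrite mulr_ge0 // oppr_ge0.
have h2 : `|v'| <= u'.
  apply: le_trans hv' _; rewrite -subr_ge0.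
  have -> : u' - 3 * eps * u' = (1 - 3 * eps) * u' by ring.
  by rewrite mulr_ge0.
have : `|v| * `|v'| <= - u * u' by apply: ler_pM.
by lra.
Qed.

(** * The limit curve *)

(** The point obtained by applying to the origin the [n] maps which the first [n]
    binary digits of [t] and the steps [sg] select. Step [k] is up if [sg k], and
    [sg \o S] is the sequence of the remaining steps. *)
Fixpoint approx n sg (t : R) : R * R :=
  if n is n'.+1 then
    if t <= 1/2 then mapL (sg 0%N) (approx n' (sg \o S) (2 * t))
    else mapR (sg 0%N) (approx n' (sg \o S) (2 * t - 1))
  else (0, 0).

(** The parametrized curve E(sg), with each half of the interval describing the
    image under one of the two maps of the first step. *)
Definition fold_curve sg (t : R) : R * R :=
  (limn (fun n => (approx n sg t).1), limn (fun n => (approx n sg t).2)).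

Lemma approx_triangle n sg t : in_triangle (approx n sg t).
Proof.
elim: n sg t => [|n IH] sg t /=; first exact: triangle0.
by case: ifP => _; [apply: mapL_triangle|apply: mapR_triangle].
Qed.

Lemma approx_step n sg t :
  sqdist (approx n.+1 sg t) (approx n sg t) <= 2 * (9/16) ^+ n.
Proof.
elim: n sg t => [|n IH] sg t.
  rewrite expr0 mulr1.
  by apply: sqdist_triangle; [apply: approx_triangle|apply: triangle0].
rewrite [approx n.+2 _ _]/=; rewrite -/(approx n.+1 _ _) -/(approx n.+1 _ _).
rewrite [approx n.+1 sg t]/=.
have hr := ratio2_le (sg 0%N); have hr0 := ratio2_gt0 (sg 0%N).
have h : forall t', ratio2 (sg 0%N) * sqdist (approx n.+1 (sg \o S) t')
    (approx n (sg \o S) t') <= 2 * (9/16) ^+ n.+1.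
  move=> t'; rewrite exprS mulrCA; apply: ler_pM => //; first exact: ltW.
  exact: sqdist_ge0.
by case: (t <= 1/2); rewrite ?sqdist_mapL ?sqdist_mapR; apply: h.
Qed.

End Folding.

Section Curve.
Variables (R : realType) (eps : R).
Hypotheses (eps_gt0 : 0 < eps) (eps_le : eps <= 1/4).
Implicit Types (b : bool) (p q : R * R) (sg : nat -> bool) (n k : nat).

Notation mapL := (mapL eps).
Notation mapR := (mapR eps).
Notation ratio2 := (ratio2 eps).
Notation in_triangle := (in_triangle eps).
Notation approx := (approx eps).
Notation fold_curve := (fold_curve eps).

Lemma approx_cvg sg t :
  (fun n => (approx n sg t).1) @ \oo --> (fold_curve sg t).1 /\
  (fun n => (approx n sg t).2) @ \oo --> (fold_curve sg t).2.
Proof.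
split; apply: cvg_geometric_step => n;
  apply: le_trans (approx_step eps_gt0 eps_le n sg t);
  by rewrite /sqdist ?lerDl ?lerDr sqr_ge0.
Qed.

Lemma mapL_cvg b (u : nat -> R * R) p :
  (fun n => (u n).1) @ \oo --> p.1 -> (fun n => (u n).2) @ \oo --> p.2 ->
  (fun n => (mapL b (u n)).1) @ \oo --> (mapL b p).1 /\
  (fun n => (mapL b (u n)).2) @ \oo --> (mapL b p).2.
Proof.
move=> h1 h2; case: b; split => /=; apply: cvgM; try exact: cvg_cst => //.
- by apply: cvgD => //; apply: cvgM => //; exact: cvg_cst.
- by apply: cvgB => //; apply: cvgM => //; exact: cvg_cst.
- exact: h1.
- exact: h2.
Qed.

Lemma mapR_cvg b (u : nat -> R * R) p :
  (fun n => (u n).1) @ \oo --> p.1 -> (fun n => (u n).2) @ \oo --> p.2 ->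
  (fun n => (mapR b (u n)).1) @ \oo --> (mapR b p).1 /\
  (fun n => (mapR b (u n)).2) @ \oo --> (mapR b p).2.
Proof.
move=> h1 h2; case: b; split => /=; apply: cvgM; try exact: cvg_cst => //.
- apply: cvgB; first by apply: cvgD => //; exact: cvg_cst.
  by apply: cvgM => //; exact: cvg_cst.
- apply: cvgB => //; apply: cvgB; first exact: cvg_cst.
  by apply: cvgM => //; exact: cvg_cst.
- by apply: cvgD => //; exact: cvg_cst.
- exact: h2.
Qed.

Lemma fold_curve_lim sg t p :
  (fun n => (approx n.+1 sg t).1) @ \oo --> p.1 ->
  (fun n => (approx n.+1 sg t).2) @ \oo --> p.2 -> fold_curve sg t = p.
Proof.
have [h1 h2] := approx_cvg sg t.
move=> g1 g2; rewrite [LHS]surjective_pairing [RHS]surjective_pairing.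
have s1 : (fun n => (approx n.+1 sg t).1) @ \oo --> (fold_curve sg t).1.
  by rewrite (cvg_shiftS (fun n => (approx n sg t).1)).
have s2 : (fun n => (approx n.+1 sg t).2) @ \oo --> (fold_curve sg t).2.
  by rewrite (cvg_shiftS (fun n => (approx n sg t).2)).
congr pair; first exact: (cvg_unique (@norm_hausdorff _ _) s1 g1).
exact: (cvg_unique (@norm_hausdorff _ _) s2 g2).
Qed.

Lemma fold_curve_step sg t : fold_curve sg t =
  if t <= 1/2 then mapL (sg 0%N) (fold_curve (sg \o S) (2 * t))
  else mapR (sg 0%N) (fold_curve (sg \o S) (2 * t - 1)).
Proof.
have [l1 l2] := approx_cvg (sg \o S) (2 * t).
have [r1 r2] := approx_cvg (sg \o S) (2 * t - 1).
by apply: fold_curve_lim => /=; case: ifP => _;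
  first [exact: (mapL_cvg _ l1 l2).1 | exact: (mapL_cvg _ l1 l2).2
        |exact: (mapR_cvg _ r1 r2).1 | exact: (mapR_cvg _ r1 r2).2].
Qed.

Lemma fold_curve_triangle sg t : in_triangle (fold_curve sg t).
Proof.
have [h1 h2] := approx_cvg sg t.
have hc (a : R) : (fun=> a) @ \oo --> a by exact: cvg_cst.
have tr n : in_triangle (approx n sg t) by exact: approx_triangle.
split.
- by apply: (ler_cvg_to (hc 0) h2); near=> n; case: (tr n).
- by apply: (ler_cvg_to h2 (cvgM (hc eps) h1)); near=> n; case: (tr n).
- apply: (ler_cvg_to h2 (cvgM (hc eps) (cvgB (hc 1) h1))).
  by near=> n; case: (tr n).
Unshelve. all: by end_near.
Qed.

Lemma sqdist_ratio_le b (x : R) n :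
  0 <= x -> x <= 2 * (9/16) ^+ n -> ratio2 b * x <= 2 * (9/16) ^+ n.+1.
Proof.
move=> x0 hx; rewrite exprS mulrCA; apply: ler_pM => //.
  exact/ltW/ratio2_gt0.
exact: ratio2_le.
Qed.

Lemma fold_curve_near0 n sg t : t <= 2^-1 ^+ n ->
  sqdist (fold_curve sg t) (0, 0) <= 2 * (9/16) ^+ n.
Proof.
elim: n sg t => [|n IH] sg t ht.
  rewrite expr0 mulr1; apply: (sqdist_triangle eps_gt0 eps_le).
    exact: fold_curve_triangle.
  exact: triangle0.
have h1 : 2 * t <= 2^-1 ^+ n by rewrite exprS in ht; lra.
have h2 : t <= 1/2.
  have : 2^-1 ^+ n <= 1 :> R by rewrite exprn_ile1 //; lra.
  by lra.
rewrite fold_curve_step h2 -(mapL0 eps (sg 0%N)) sqdist_mapL.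
by apply: sqdist_ratio_le; [exact: sqdist_ge0|exact: IH].
Qed.

Lemma le_geometric_le0 (x : R) : (forall n, x <= 2 * (9/16) ^+ n) -> x <= 0.
Proof.
move=> h; rewrite leNgt; apply/negP => x0.
have [n hn] := geometric_below (@lt01_9_16 R) (ltr0n R 2) x0.
by have := lt_le_trans hn (h n); rewrite ltxx.
Qed.

Lemma fold_curve0 sg : fold_curve sg 0 = (0, 0).
Proof.
apply/sqdist_eq0/le_geometric_le0 => n; apply: fold_curve_near0.
by rewrite exprn_ge0 // invr_ge0.
Qed.

Lemma fold_curve1 sg : fold_curve sg 1 = (1, 0).
Proof.
apply/sqdist_eq0/le_geometric_le0 => n.
elim: n sg => [|n IH] sg.
  rewrite expr0 mulr1; apply: (sqdist_triangle eps_gt0 eps_le).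
    exact: fold_curve_triangle.
  exact: triangle1.
rewrite fold_curve_step ifF; last by apply/negbTE; rewrite -ltNge; lra.
have -> : 2 * 1 - 1 = 1 :> R by ring.
rewrite -(mapR1 eps (sg 0%N)) sqdist_mapR.
by apply: sqdist_ratio_le; [exact: sqdist_ge0|exact: IH].
Qed.

Lemma fold_curveL sg t : t <= 1/2 ->
  fold_curve sg t = mapL (sg 0%N) (fold_curve (sg \o S) (2 * t)).
Proof. by move=> h; rewrite fold_curve_step h. Qed.

Lemma fold_curveR sg t : 1/2 <= t ->
  fold_curve sg t = mapR (sg 0%N) (fold_curve (sg \o S) (2 * t - 1)).
Proof.
rewrite le_eqVlt => /predU1P[<-|h]; last by rewrite fold_curve_step leNgt h.
rewrite fold_curveL //.
have -> : 2 * (1 / 2) = 1 :> R by field.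
by rewrite subrr fold_curve0 fold_curve1 mapL1.
Qed.

Lemma fold_curve_near1 n sg t : 1 - 2^-1 ^+ n <= t ->
  sqdist (fold_curve sg t) (1, 0) <= 2 * (9/16) ^+ n.
Proof.
elim: n sg t => [|n IH] sg t ht.
  rewrite expr0 mulr1; apply: (sqdist_triangle eps_gt0 eps_le).
    exact: fold_curve_triangle.
  exact: triangle1.
have h1 : 1 - 2^-1 ^+ n <= 2 * t - 1 by rewrite exprS in ht; lra.
have h2 : 1/2 <= t.
  have : 2^-1 ^+ n <= 1 :> R by rewrite exprn_ile1 //; lra.
  by lra.
rewrite fold_curveR // -(mapR1 eps (sg 0%N)) sqdist_mapR.
by apply: sqdist_ratio_le; [exact: sqdist_ge0|exact: IH].
Qed.

(** Parameters at distance at most 2 ^- n either lie in one half, to which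
    induction applies, or are both close to 1/2. *)
Lemma fold_curve_modulus n sg x y : x <= y -> y - x <= 2^-1 ^+ n ->
  sqdist (fold_curve sg x) (fold_curve sg y) <= 8 * (9/16) ^+ n.
Proof.
elim: n sg x y => [|n IH] sg x y xy hxy.
  rewrite expr0 mulr1; apply: (@le_trans _ _ 2); last by lra.
  by apply: (sqdist_triangle eps_gt0 eps_le); exact: fold_curve_triangle.
rewrite exprS in hxy.
have r0 := ratio2_gt0 eps (sg 0%N); have r1 := ratio2_le eps_gt0 eps_le (sg 0%N).
have hr z : 0 <= z -> z <= 8 * (9/16) ^+ n ->
    ratio2 (sg 0%N) * z <= 8 * (9/16) ^+ n.+1.
  by move=> z0 hz; rewrite exprS mulrCA; apply: ler_pM => //; exact: ltW.
have [y2|y2] := leP y (1/2).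
  rewrite (@fold_curveL sg x) ?(@fold_curveL sg y) ?sqdist_mapL; try lra.
  by apply: hr; [exact: sqdist_ge0|apply: IH; lra].
have [x2|x2] := leP x (1/2); last first.
  rewrite (@fold_curveR sg x) ?(@fold_curveR sg y) ?sqdist_mapR; try lra.
  by apply: hr; [exact: sqdist_ge0|apply: IH; lra].
rewrite (@fold_curveL sg x) // (@fold_curveR sg y) ?(ltW y2) //.
apply: le_trans (sqdist_le_add _ _ (mapL (sg 0%N) (1, 0))) _.
rewrite sqdist_mapL mapL1 sqdist_mapR.
have a1 : ratio2 (sg 0%N) * sqdist (fold_curve (sg \o S) (2 * x)) (1, 0)
    <= 2 * (9/16) ^+ n.+1.
  by apply: sqdist_ratio_le; [exact: sqdist_ge0|apply: fold_curve_near1; lra].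
have a2 : ratio2 (sg 0%N) * sqdist (fold_curve (sg \o S) (2 * y - 1)) (0, 0)
    <= 2 * (9/16) ^+ n.+1.
  by apply: sqdist_ratio_le; [exact: sqdist_ge0|apply: fold_curve_near0; lra].
by lra.
Qed.

Lemma fold_curve_continuous sg : continuous (fold_curve sg).
Proof.
move=> x; apply/cvgrPdist_lt => e e0.
have [n hn] := geometric_below (@lt01_9_16 R) (ltr0n R 8) (exprn_gt0 2 e0).
have d0 : 0 < 2^-1 ^+ n :> R by rewrite exprn_gt0 // invr_gt0.
near=> y.
have hxy : `|x - y| <= 2^-1 ^+ n.
  by apply/ltW; near: y; apply: cvgr_dist_lt.
move: hxy; rewrite ler_norml => /andP[hxy1 hxy2].
have hd : sqdist (fold_curve sg x) (fold_curve sg y) < e ^+ 2.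
  apply: le_lt_trans hn; have [xy|yx] := leP x y.
    by apply: fold_curve_modulus => //; lra.
  by rewrite sqdistC; apply: fold_curve_modulus; lra.
have abs_lt (a : R) : a ^+ 2 < e ^+ 2 -> `|a| < e.
  by move=> h; rewrite -(@ltr_pXn2r _ 2%N) ?nnegrE ?(ltW e0) // real_normK ?num_real.
rewrite prod_normE /= gt_max; apply/andP; split; apply: abs_lt;
  by apply: le_lt_trans hd; rewrite /sqdist ?lerDl ?lerDr sqr_ge0.
Unshelve. all: by end_near.
Qed.

End Curve.

(** * Flatness, packing and covering of the folded sets *)

Section Geometry.
Variables (R : realType) (eps : R).
Hypotheses (eps_gt0 : 0 < eps) (eps_le : eps <= 1/4).
Implicit Types (b : bool) (p q v : R * R) (sg : nat -> bool) (n k : nat).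

Notation mapL := (mapL eps).
Notation mapR := (mapR eps).
Notation ratio2 := (ratio2 eps).
Notation in_triangle := (in_triangle eps).
Notation fold_curve := (fold_curve eps).

(** The trace E(sg) of the folded curve. *)
Definition fold_set sg : set (R * R) := fold_curve sg @` `[0, 1].

Lemma fold_set_triangle sg p : fold_set sg p -> in_triangle p.
Proof. by case=> t _ <-; exact: fold_curve_triangle. Qed.

Lemma fold_set_split sg p : fold_set sg p ->
  (exists2 q, fold_set (sg \o S) q & p = mapL (sg 0%N) q) \/
  (exists2 q, fold_set (sg \o S) q & p = mapR (sg 0%N) q).
Proof.
case=> t /=; rewrite in_itv /= => /andP[t0 t1] <-.
have [ht|ht] := leP t (1/2); [left|right].
  exists (fold_curve (sg \o S) (2 * t)); last by rewrite fold_curveL.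
  by exists (2 * t) => //=; rewrite in_itv /=; apply/andP; split; lra.
exists (fold_curve (sg \o S) (2 * t - 1)); last first.
  by rewrite (fold_curveR eps_gt0) // ltW.
by exists (2 * t - 1) => //=; rewrite in_itv /=; apply/andP; split; lra.
Qed.

Lemma fold_set_mapL sg q :
  fold_set (sg \o S) q -> fold_set sg (mapL (sg 0%N) q).
Proof.
case=> t /=; rewrite in_itv /= => /andP[t0 t1] <-.
exists (t / 2); first by rewrite /= in_itv /=; apply/andP; split; lra.
by rewrite fold_curveL //; [congr (mapL _ (fold_curve _ _)); field|lra].
Qed.

Lemma fold_set_mapR sg q :
  fold_set (sg \o S) q -> fold_set sg (mapR (sg 0%N) q).
Proof.
case=> t /=; rewrite in_itv /= => /andP[t0 t1] <-.
exists ((t + 1) / 2); first by rewrite /= in_itv /=; apply/andP; split; lra.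
rewrite (fold_curveR eps_gt0 eps_le); last by lra.
by congr (mapR _ (fold_curve _ _)); field.
Qed.

Lemma mapL_affine b p v t : mapL b (p.1 + t * v.1, p.2 + t * v.2) =
  ((mapL b p).1 + t * ((mapL b v).1 - (mapL b (0, 0)).1),
   (mapL b p).2 + t * ((mapL b v).2 - (mapL b (0, 0)).2)).
Proof. by case: b; congr pair => /=; field. Qed.

Lemma mapR_affine b p v t : mapR b (p.1 + t * v.1, p.2 + t * v.2) =
  ((mapR b p).1 + t * ((mapR b v).1 - (mapR b (0, 0)).1),
   (mapR b p).2 + t * ((mapR b v).2 - (mapR b (0, 0)).2)).
Proof. by case: b; congr pair => /=; field. Qed.

(** A vector ([u], [v]) in the horizontal cone of slope 3 eps, of squared length at
    most [d]. *)
Lemma cone_sq (u v d : R) : `|v| <= `|3 * eps * u| -> u ^+ 2 + v ^+ 2 <= d ->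
  v ^+ 2 <= (3 * eps) ^+ 2 * d.
Proof.
move=> hv hd; apply: (@le_trans _ _ ((3 * eps) ^+ 2 * u ^+ 2)).
  rewrite -exprMn -(real_normK (num_real v)) -(real_normK (num_real (_ * u))).
  by rewrite lerXn2r ?nnegrE.
apply: ler_wpM2l; first exact: sqr_ge0.
by apply: le_trans hd; rewrite lerDl sqr_ge0.
Qed.

(** A subset of E(sg) of diameter at most d, here with [d] the square of that
    bound, lies within 3 eps d of a line. The induction variable [n] only bounds the
    number of times that [A] can lie in one half, since each time [d] grows by a
    factor of at least 16/9 when the half is scaled to unit size. *)
Lemma fold_set_flat n sg (A : set (R * R)) (d : R) :
  A `<=` fold_set sg -> (forall x y, A x -> A y -> sqdist x y <= d) ->
  (9/16) ^+ n <= d -> near_line A ((3 * eps) ^+ 2 * d).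
Proof.
elim: n sg A d => [|n IH] sg A d AE Ad hd.
  exists (0, 0), (1, 0); split; first by apply/eqP => -[/eqP]; rewrite oner_eq0.
  move=> x /AE /fold_set_triangle tx; exists x.1.
  have /andP[x0 x1] := triangle_x eps_gt0 tx.
  rewrite /sqdist /= mulr1 mulr0 !add0r subrr subr0 expr0n /= add0r.
  case: tx => h0 h1 h2; rewrite expr0 in hd.
  apply: (@le_trans _ _ (eps ^+ 2)).
    rewrite ler_pXn2r ?nnegrE ?(ltW eps_gt0) //; apply: le_trans h1 _.
    by rewrite ler_piMr // ltW.
  rewrite exprMn -mulrA mulrCA ler_peMr ?sqr_ge0 //.
  by rewrite (_ : 3 ^+ 2 = 9) ; [lra|ring].
have r0 := ratio2_gt0 eps (sg 0%N); have r1 := ratio2_le eps_gt0 eps_le (sg 0%N).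
have q0 : 0 < (9/16) ^+ n :> R by rewrite exprn_gt0 //; lra.
have hd' : (9/16) ^+ n <= (ratio2 (sg 0%N))^-1 * d.
  rewrite ler_pdivlMl //; apply: le_trans hd.
  by rewrite exprS ler_wpM2r // ltW.
have step (F : R * R -> R * R) :
    (forall p q, sqdist (F p) (F q) = ratio2 (sg 0%N) * sqdist p q) ->
    (forall p v t, F (p.1 + t * v.1, p.2 + t * v.2) =
     ((F p).1 + t * ((F v).1 - (F (0, 0)).1),
      (F p).2 + t * ((F v).2 - (F (0, 0)).2))) ->
    (forall x, A x -> exists2 q, fold_set (sg \o S) q & x = F q) ->
    near_line A ((3 * eps) ^+ 2 * d).
  move=> Fs Fa AF.
  have [|x y [Ex Ax] [Ey Ay]|p [v [v0 hv]]] :=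
    IH (sg \o S) (fold_set (sg \o S) `&` F @^-1` A) _ _ _ hd'.
  - by move=> x [].
  - by rewrite ler_pdivlMl // -Fs; exact: Ad.
  have := near_line_similar r0 Fs Fa (ex_intro _ p (ex_intro _ v (conj v0 hv))).
  rewrite mulrCA mulVKf ?gt_eqF //.
  case=> p' [v' [v0' hv']]; exists p', v'; split => // x Ax; apply: hv'.
  by have [q Eq xq] := AF _ Ax; exists q => //; split => //=; rewrite -xq.
have [[q Eq Aq]|nL] :=
  pselect (exists2 q, fold_set (sg \o S) q & A (mapL (sg 0%N) q)); last first.
  apply: (step (mapR (sg 0%N))); [exact: sqdist_mapR|exact: mapR_affine|].
  move=> x Ax; have [[q Eq xq]|//] := fold_set_split (AE _ Ax).
  by case: nL; exists q; rewrite -?xq.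
have [[q' Eq' Aq']|nR] :=
  pselect (exists2 q, fold_set (sg \o S) q & A (mapR (sg 0%N) q)); last first.
  apply: (step (mapL (sg 0%N))); [exact: sqdist_mapL|exact: mapL_affine|].
  move=> x Ax; have [//|[z Ez xz]] := fold_set_split (AE _ Ax).
  by case: nR; exists z; rewrite -?xz.
(* [A] meets both halves: the horizontal line through their common point. *)
exists (mapL (sg 0%N) (1, 0)), (1, 0); split.
  by apply/eqP => -[/eqP]; rewrite oner_eq0.
have key x : `|x.2 - (mapL (sg 0%N) (1, 0)).2| <=
      `|3 * eps * (x.1 - (mapL (sg 0%N) (1, 0)).1)| ->
    sqdist x (mapL (sg 0%N) (1, 0)) <= d ->
    exists t, sqdist x ((mapL (sg 0%N) (1, 0)).1 + t * 1,
      (mapL (sg 0%N) (1, 0)).2 + t * 0) <= (3 * eps) ^+ 2 * d.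
  move=> h1 h2; exists (x.1 - (mapL (sg 0%N) (1, 0)).1).
  rewrite /sqdist /= mulr1 mulr0 addr0 subrKC subrr expr0n /= add0r.
  exact: cone_sq h1 h2.
move=> x Ax; apply: key; have [[z Ez xz]|[z Ez xz]] := fold_set_split (AE _ Ax).
- have [u0 hv] := mapL_cone eps_gt0 eps_le (sg 0%N) (fold_set_triangle Ez).
  by rewrite xz; apply: le_trans hv _; rewrite -normrN ler_norm.
- have [u0 hv] := mapR_cone eps_gt0 eps_le (sg 0%N) (fold_set_triangle Ez).
  by rewrite xz; apply: le_trans hv _; rewrite ler_norm.
- have := obtuse_angle eps_gt0 eps_le (sg 0%N)
    (fold_set_triangle Ez) (fold_set_triangle Eq').
  have := sqdist_ge0 (mapR (sg 0%N) q') (mapL (sg 0%N) (1, 0)).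
  by rewrite -xz; have := Ad _ _ Ax Aq'; lra.
- have := obtuse_angle eps_gt0 eps_le (sg 0%N)
    (fold_set_triangle Eq) (fold_set_triangle Ez).
  have := sqdist_ge0 (mapL (sg 0%N) q) (mapL (sg 0%N) (1, 0)).
  by rewrite -xz; have := Ad _ _ Aq Ax; lra.
Qed.

(** The square of the common size r_k of the 2 ^ k pieces of stage [k]. *)
Definition scale2 k sg : R := \prod_(i < k) ratio2 (sg i).

Lemma scale2S k sg : scale2 k.+1 sg = ratio2 (sg 0%N) * scale2 k (sg \o S).
Proof. by rewrite /scale2 big_ord_recl. Qed.

Lemma scale2_gt0 k sg : 0 < scale2 k sg.
Proof. by apply: prodr_gt0 => i _; exact: ratio2_gt0. Qed.

Lemma expn2S k : (2 ^ k.+1 = 2 ^ k + 2 ^ k)%N.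
Proof. by rewrite expnS mul2n addnn. Qed.

(** The points are the left end points of the pieces of stage [k]. That the right
    end point (1, 0) of the curve is also far from all of them is needed for the
    induction: the points in the left half are compared with those in the right
    half through the common point, which is the right end point of the left half. *)
Lemma fold_set_packing k sg : exists z : nat -> R * R,
  (forall i, (i < 2 ^ k)%N ->
     fold_set sg (z i) /\ scale2 k sg <= sqdist (z i) (1, 0)) /\
  (forall i j, (i < j)%N -> (j < 2 ^ k)%N ->
     scale2 k sg <= sqdist (z i) (z j)).
Proof.
elim: k sg => [|k IH] sg.
  exists (fun=> (0, 0)); split; last by case=> [|i] [|j].
  move=> i _; split.
    by exists 0; rewrite ?fold_curve0 //= in_itv /= lexx ler01.
  by rewrite /scale2 big_ord0 /sqdist /= subrr sub0r sqrrN expr1n expr0n /= addr0.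
have [z [hz zz]] := IH (sg \o S).
have r0 := ratio2_gt0 eps (sg 0%N).
have cross i q : (i < 2 ^ k)%N -> in_triangle q ->
    scale2 k.+1 sg <= sqdist (mapL (sg 0%N) (z i)) (mapR (sg 0%N) q).
  move=> ik tq; have [Ez z1] := hz _ ik.
  have := obtuse_angle eps_gt0 eps_le (sg 0%N) (fold_set_triangle Ez) tq.
  have := sqdist_ge0 (mapR (sg 0%N) q) (mapL (sg 0%N) (1, 0)).
  rewrite sqdist_mapL scale2S.
  have : ratio2 (sg 0%N) * scale2 k (sg \o S)
      <= ratio2 (sg 0%N) * sqdist (z i) (1, 0).
    by rewrite ler_pM2l.
  by lra.
exists (fun i => if (i < 2 ^ k)%N then mapL (sg 0%N) (z i)
                 else mapR (sg 0%N) (z (i - 2 ^ k)%N)).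
split=> [i ik|i j ij jk].
  case: ifPn => [ik'|]; [|rewrite -leqNgt => ki].
    have [Ez z1] := hz _ ik'; split; first exact: fold_set_mapL.
    rewrite -(mapR1 eps (sg 0%N)); apply: cross => //.
    exact: triangle1.
  have [|Ez z1] := hz (i - 2 ^ k)%N; first by rewrite ltn_subLR // -expn2S.
  split; first exact: fold_set_mapR.
  by rewrite -(mapR1 eps (sg 0%N)) sqdist_mapR scale2S ler_pM2l.
case: ifPn => [ik'|]; case: ifPn => [jk'|].
- by rewrite sqdist_mapL scale2S ler_pM2l //; exact: zz.
- rewrite -leqNgt => kj.
  have [|Ez z1] := hz (j - 2 ^ k)%N; first by rewrite ltn_subLR // -expn2S.
  by apply: cross => //; exact: fold_set_triangle Ez.
- by rewrite -leqNgt => ki; have := leq_trans (ltn_trans ij jk') ki; rewrite ltnn.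
- rewrite -!leqNgt => kj ki; rewrite sqdist_mapR scale2S ler_pM2l //; apply: zz.
    by rewrite ltn_sub2r // (leq_ltn_trans ki).
  by rewrite ltn_subLR // -expn2S.
Qed.

Lemma fold_set_cover k sg : exists A : nat -> set (R * R),
  (forall p, fold_set sg p -> exists2 i, (i < 2 ^ k)%N & A i p) /\
  (forall i p q, A i p -> A i q -> sqdist p q <= 2 * scale2 k sg).
Proof.
elim: k sg => [|k IH] sg.
  exists (fun=> fold_set sg); split=> [p Ep|i p q Ep Eq]; first by exists 0%N.
  rewrite /scale2 big_ord0 mulr1.
  exact: (sqdist_triangle eps_gt0 eps_le
    (fold_set_triangle Ep) (fold_set_triangle Eq)).
have [A [cA dA]] := IH (sg \o S).
have r0 := ratio2_gt0 eps (sg 0%N).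
exists (fun i => if (i < 2 ^ k)%N then mapL (sg 0%N) @` A i
                 else mapR (sg 0%N) @` A (i - 2 ^ k)%N); split=> [p|i p q].
  case/fold_set_split => -[q /cA [i ik Aq] ->].
    exists i; first by rewrite expn2S ltn_addr.
    by rewrite ik; exists q.
  exists (2 ^ k + i)%N; first by rewrite expn2S ltn_add2l.
  by rewrite ltnNge leq_addr /= addKn; exists q.
by case: ifP => _ [p' Ap' <-] [q' Aq' <-];
  rewrite ?sqdist_mapL ?sqdist_mapR scale2S mulrCA ler_pM2l //; exact: dA Ap' Aq'.
Qed.

End Geometry.

(** * Weights and the proposition *)

Section Main.
Variables (R : realType) (eps : R).
Hypotheses (eps_gt0 : 0 < eps) (eps_le : eps <= 1/4).

Lemma fold_set_curve sg : is_curve (fold_set eps sg).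
Proof.
exists (fold_curve eps sg); split=> //; apply: continuous_subspaceT.
exact: fold_curve_continuous.
Qed.

Lemma fold_set_beta sg (Q : set (R * R)) : dyadic_squares Q ->
  (beta_number (fold_set eps sg) Q <= (3 * eps)%:E)%E.
Proof.
move=> /diam2_dyadic[d d0 dQ].
apply: (beta_number_le _ d0 dQ); first by rewrite mulr_ge0 // ltW.
have [n hn] := geometric_below (@lt01_9_16 R) ltr01 (exprn_gt0 2 d0).
apply: (fold_set_flat eps_gt0 eps_le (n := n) (sg := sg)); first by move=> x [].
  move=> x y [_ Qx] [_ Qy]; rewrite -edist2_leP ?(ltW d0) // -lee_fin -dQ.
  exact: edist2_le_diam2.
by rewrite -[X in X <= _]mul1r; exact: ltW.
Qed.

(** The factor by which a step multiplies w_k = 2 ^ k * r_k ^ s. *)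
Definition piece_weight (s : R) (b : bool) : R := 2 * ratio2 eps b `^ (s / 2).

Lemma scale2_weight (s : R) k sg :
  (2 ^ k)%:R * scale2 eps k sg `^ (s / 2) = \prod_(i < k) piece_weight s (sg i).
Proof.
elim: k => [|k IH]; first by rewrite /scale2 !big_ord0 powR1 mulr1.
rewrite big_ord_recr /= -IH /scale2 big_ord_recr /= powRM; first last.
- exact/ltW/ratio2_gt0.
- exact/ltW/scale2_gt0.
by rewrite expn2S natrD /piece_weight; ring.
Qed.

Lemma scale2_le k sg : scale2 eps k sg <= (9/16) ^+ k.
Proof.
rewrite -[k in _ ^+ k]card_ord -prodr_const; apply: ler_prod => i _.
by rewrite ratio2_le // ltW // ratio2_gt0.
Qed.

Lemma fold_set_hausdorff (s : R) (sg : nat -> bool) : 0 < s ->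
  (forall N, exists2 k, (N <= k)%N & \prod_(i < k) piece_weight s (sg i) <= 1) ->
  (hausdorff_measure s (fold_set eps sg) <= (2 `^ (s / 2))%:E)%E.
Proof.
move=> s0 hw; apply: hausdorff_measure_le => // delta d0.
have [N hN] := geometric_below (@lt01_9_16 R) (ltr0n R 2) (exprn_gt0 2 d0).
have [k Nk wk] := hw N; have [A [cA dA]] := fold_set_cover eps_gt0 eps_le k sg.
have r0 := scale2_gt0 eps k sg.
have r2 : 0 <= 2 * scale2 eps k sg by rewrite mulr_ge0 // ltW.
exists (2 ^ k)%N, A, (Num.sqrt (2 * scale2 eps k sg)); split=> //.
- rewrite sqrtr_ge0 /= -(ger0_norm (ltW d0)) -sqrtr_sqr ler_wsqrtr //.
  apply: le_trans (ltW hN); rewrite ler_pM2l //; apply: le_trans (scale2_le _ _) _.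
  by apply: ler_wiXn2l => //; lra.
- by move=> i p q Ap Aq; rewrite edist2E ler_wsqrtr //; exact: dA Ap Aq.
- rewrite -(powR12_sqrt r2) -powRrM [2^-1 * s]mulrC powRM ?(ltW r0) //.
  by rewrite mulrCA scale2_weight ler_piMr // powR_ge0.
Qed.

Lemma fold_set_not_holder (s : R) (sg : nat -> bool) : 0 < s ->
  (forall M, exists2 k, (0 < k)%N & M < \prod_(i < k) piece_weight s (sg i)) ->
  ~ exists (f : R -> R * R) (H : R),
      holder_on_unit (1 / s) H f /\ fold_set eps sg `<=` f @` `[0, 1].
Proof.
move=> s0 hw [f [H [fH Ef]]].
have [k k0] := hw (2 * (`|H| + 1) `^ s).
apply/negP; rewrite -leNgt -scale2_weight.
have [z [hz zz]] := fold_set_packing eps_gt0 eps_le k sg.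
apply: (holder_packing s0 fH (scale2_gt0 eps k sg) _ _ zz).
  by rewrite -(expn0 2) ltn_exp2l.
by move=> i ik; apply: Ef; case: (hz i ik).
Qed.

(** The exponent s0 is the similarity dimension of the curve with up steps only,
    the solution of 2 * ratio ^ s0 = 1; the bounds 1 < s0 < 2 mean that the squared
    ratio lies strictly between 1/4 and 1/2. *)
Lemma critical_exponent : exists2 s0 : R, 1 < s0 < 2 &
  forall s, s < s0 -> 1 < piece_weight s true.
Proof.
have q0 := ratio2_gt0 eps true; have he := eps_sq_le eps_gt0 eps_le.
have e2 : 0 < eps ^+ 2 by rewrite exprn_gt0.
pose q := ratio2 eps true; rewrite -/q in q0.
have l2 : 0 < ln (2 : R) by rewrite ln_gt0 // ltr1n.
have lq : ln q < - ln 2.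
  rewrite -lnV ?posrE // ltr_ln ?posrE ?invr_gt0 //.
  by rewrite /q /ratio2; lra.
have lq' : - (2 * ln 2) < ln q.
  rewrite mulr_natl -lnXn // -lnV ?posrE ?exprn_gt0 //.
  rewrite ltr_ln ?posrE ?invr_gt0 ?exprn_gt0 //.
  by rewrite /q /ratio2 expr2; lra.
have nq : 0 < - ln q by lra.
exists (2 * ln 2 / - ln q).
  by rewrite ltr_pdivlMr // ltr_pdivrMr //; apply/andP; split; lra.
move=> s; rewrite ltr_pdivlMr // => hs.
have w0 : 0 < piece_weight s true by rewrite mulr_gt0 // powR_gt0.
rewrite -ltr_ln ?posrE // ln1 lnM ?posrE ?powR_gt0 // ln_powR -/q.
by lra.
Qed.

Lemma straight_weight_lt1 (s : R) : 1 < s -> 0 < piece_weight s false < 1.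
Proof.
move=> s1; have w0 : 0 < piece_weight s false.
  by rewrite mulr_gt0 // powR_gt0 // ratio2_gt0.
rewrite w0 /= -ltr_ln ?posrE // ln1 lnM ?posrE ?powR_gt0 ?ratio2_gt0 //.
rewrite ln_powR /ratio2; have -> : (1 / 4 : R) = (2 ^+ 2)^-1 by field.
rewrite lnV ?posrE ?exprn_gt0 // lnXn // -[ln 2 *+ 2]mulr_natl.
have l2 : 0 < ln (2 : R) by rewrite ln_gt0 // ltr1n.
have : 0 < (s - 1) * ln 2 by rewrite mulr_gt0 // subr_gt0.
by lra.
Qed.
End Main.

Unset Implicit Arguments.
Theorem proposition9p8 (R : realType) (beta0 : R) (hbeta0 : 0 < beta0 < 1) :
  exists s0 : R, 1 < s0 < 2 /\
    forall s : R, 1 < s < s0 ->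
      exists E : set (R * R),
        [/\ is_curve E,
            (hausdorff_measure s E < +oo)%E,
            (forall Q : set (R * R), dyadic_squares Q ->
               (beta_number E Q < beta0%:E)%E)
          & ~ exists (f : R -> R * R) (H : R),
                holder_on_unit (1 / s) H f /\ E `<=` f @` `[0, 1]].
Proof.
have /andP[b0 b1] := hbeta0.
have e0 : 0 < beta0 / 4 by lra.
have e1 : beta0 / 4 <= 1/4 by lra.
have [s0 s01 up] := critical_exponent e0 e1.
exists s0; split=> // s /andP[s1 ss0].
have sp : 0 < s by apply: lt_trans s1.
have [sg [lo hi]] :=
  oscillating_products (up s ss0) (straight_weight_lt1 (beta0 / 4) s1).
have wE k : \prod_(i < k) (if sg i then piece_weight (beta0 / 4) s true
      else piece_weight (beta0 / 4) s false) =
    \prod_(i < k) piece_weight (beta0 / 4) s (sg i).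
  by apply: eq_bigr => i _; case: (sg i).
exists (fold_set (beta0 / 4) sg); split.
- exact: fold_set_curve.
- apply: le_lt_trans (fold_set_hausdorff e0 e1 sp _) (ltry _).
  by move=> N; have [k Nk] := lo N; rewrite wE; exists k.
- move=> Q /(fold_set_beta e0 e1 sg) /le_lt_trans; apply.
  by rewrite lte_fin; lra.
- apply: fold_set_not_holder => // M.
  by have [k k0] := hi M; rewrite wE; exists k.
Qed.
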